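(* Let $R$ be a ring such that the class of Gorenstein AC-flat $R$-modules is closed under extensions. Then an $R$-module is Gorenstein AC-flat if and only if it is a direct summand of a strongly Gorenstein AC-flat $R$-module.
   Context: Rings are associative and unital; $R$-module means left $R$-module. $\mathrm{FP}_\infty$ is the class of modules having a resolution by finitely generated projective modules. A right $R$-module $A$ is absolutely clean if $\mathrm{Ext}^1_R(F,A)=0$ for all right $R$-modules $F\in\mathrm{FP}_\infty$. An $R$-module $M$ is Gorenstein AC-flat if there is an exact complex of flat modules $\mathbf F=\cdots\to F_1\to F_0\to F_{-1}\to\cdots$ such that $A\otimes_R\mathbf F$ is exact for every absolutely clean right $R$-module $A$ and $M$ is one of the cycles of $\mathbf F$. An $R$-module $M$ is strongly Gorenstein AC-flat if there is an exact complex of flat modules of the form $\mathbf F=\cdots\xrightarrow{d}F\xrightarrow{d}F\xrightarrow{d}F\xrightarrow{d}\cdots$ (all terms and all differentials the same) such that $A\otimes_R\mathbf F$ is exact for every absolutely clean right $R$-module $A$ and $M=\mathrm{Ker}(d\colon F\to F)$. *)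

(* Defs.v *)
From HB Require Import structures.
From mathcomp Require Import all_boot ssralg ssrint generic_quotient ring_quotient.
From mathcomp Require Import boolp.
From mathcomp Require Import freeg.

Set Implicit Arguments.
Unset Strict Implicit.
Unset Printing Implicit Defensive.

Import GRing.Theory.
Local Open Scope ring_scope.
Local Open Scope quotient_scope.

(* A right R-module is a left module over the converse ring R^c; the action
   a . r is written  ract a r,  and  (a . r) . s = a . (r * s)  holds. *)
Notation rmodType R := (lmodType (R : pzRingType)^c).

Definition ract (R : pzRingType) (A : rmodType R) (a : A) (r : R) : A :=
  (r : R^c) *: a.

Lemma ractA (R : pzRingType) (A : rmodType R) (a : A) (r s : R) :
  ract (ract a r) s = ract a (r * s).
Proof. by rewrite /ract scalerA. Qed.

(* ------------------------------------------------------------------------ *)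
(* Tensor product of a right and a left module: the free abelian group on    *)
(* A * M modulo the subgroup generated by the bilinearity and balancedness   *)
(* relators.                                                                 *)

Section Tensor.
Variables (R : pzRingType) (A : rmodType R) (M : lmodType R).

Inductive tensor_rel : {freeg (A * M)%type / int} -> Prop :=
| TensorRel0 : tensor_rel 0
| TensorRelB x y : tensor_rel x -> tensor_rel y -> tensor_rel (x - y)
| TensorRelDl a a' m :
    tensor_rel (<< (a + a', m) >> - << (a, m) >> - << (a', m) >>)
| TensorRelDr a m m' :
    tensor_rel (<< (a, m + m') >> - << (a, m) >> - << (a, m') >>)
| TensorRelZ a r m : tensor_rel (<< (ract a r, m) >> - << (a, r *: m) >>).

Definition tensor_relb : {pred {freeg (A * M)%type / int}} :=
  fun x => `[< tensor_rel x >].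

Lemma tensor_relb_zmod_closed : zmod_closed tensor_relb.
Proof.
split; first exact/asboolP/TensorRel0.
by move=> x y /asboolP hx /asboolP hy; exact/asboolP/TensorRelB.
Qed.

HB.instance Definition _ :=
  GRing.isZmodClosed.Build _ tensor_relb tensor_relb_zmod_closed.

Local Notation quot := (Quotient.quot tensor_relb).

Definition tensor : zmodType := quot.

Definition tens (a : A) (m : M) : tensor := \pi_quot << (a, m) >>.

Let pi (x : {freeg (A * M)%type / int}) : tensor := \pi_quot x.

Let piD x y : pi (x + y) = pi x + pi y.
Proof. exact: (Quotient.pi_add tensor_relb). Qed.

Let piN x : pi (- x) = - pi x.
Proof. exact: (Quotient.pi_opp tensor_relb). Qed.

Let pi_surj x : exists y, x = pi y.
Proof. by exists (repr (x : quot)); rewrite /pi reprK. Qed.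

Let pi_eq x y : tensor_rel (x - y) <-> pi x = pi y.
Proof.
split=> [h|/eqP]; first by apply/eqP; rewrite -Quotient.idealrBE; apply/asboolP.
by rewrite -Quotient.idealrBE => /asboolP.
Qed.

Definition balanced (G : zmodType) (f : A -> M -> G) : Prop :=
  [/\ forall a a' m, f (a + a') m = f a m + f a' m,
      forall a m m', f a (m + m') = f a m + f a m'
    & forall a r m, f (ract a r) m = f a (r *: m)].

Lemma tens_balanced : balanced tens.
Proof.
split=> [a a' m|a m m'|a r m]; rewrite /tens -!/(pi _) -?piD; apply/pi_eq.
- by rewrite opprD addrA; exact: TensorRelDl.
- by rewrite opprD addrA; exact: TensorRelDr.
- exact: TensorRelZ.
Qed.

(* The additive map sending tens a m to f a m; only meaningful when f is
   balanced. The type zmodule G is G seen as a Z-module. *)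
Definition tensor_lift (G : zmodType) (f : A -> M -> G) (x : tensor) : G :=
  fglift (fun am => f am.1 am.2 : zmodule G) (repr (x : quot)).

Section Lift.
Variables (G : zmodType) (f : A -> M -> G).
Hypothesis fP : balanced f.

Let lift := fglift (fun am => f am.1 am.2 : zmodule G).

Let liftB x y : lift (x - y) = lift x - lift y.
Proof. exact: (lift_is_additive (fun am => f am.1 am.2 : zmodule G)). Qed.

Let liftU am : lift << am >> = f am.1 am.2.
Proof. by rewrite /lift liftU scale1r. Qed.

Let lift_rel x : tensor_rel x -> lift x = 0.
Proof.
case: fP => fDl fDr fZ; elim=> [|y z _ y0 _ z0|a a' m|a m m'|a r m].
- by rewrite -(subrr 0) liftB subrr.
- by rewrite liftB y0 z0 subrr.
- by rewrite !liftB !liftU /= fDl addrAC addrK subrr.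
- by rewrite !liftB !liftU /= fDr addrAC addrK subrr.
- by rewrite !liftB !liftU /= fZ subrr.
Qed.

Let lift_pi x : tensor_lift f (pi x) = lift x.
Proof.
apply/eqP; rewrite -subr_eq0 -/(lift _) -liftB; apply/eqP/lift_rel/pi_eq.
exact: (reprK (pi x : quot)).
Qed.

Lemma tensor_liftE a m : tensor_lift f (tens a m) = f a m.
Proof. by rewrite lift_pi liftU. Qed.

Lemma tensor_lift_additive : zmod_morphism (tensor_lift f).
Proof.
move=> x y; have [u ->] := pi_surj x; have [v ->] := pi_surj y.
by rewrite -piN -piD !lift_pi liftB.
Qed.
End Lift.

Lemma tensor_ind (P : tensor -> Prop) :
  (forall x y, P x -> P y -> P (x - y)) -> (forall a m, P (tens a m)) ->
  forall x, P x.
Proof.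
move=> PB Pt x; have [u ->] := pi_surj x.
have P0 : P 0 by rewrite -(subrr (tens 0 0)); apply: PB.
have PN y : P y -> P (- y) by move=> Py; rewrite -sub0r; apply: PB.
have PD y z : P y -> P z -> P (y + z).
  by move=> Py Pz; rewrite -[z]opprK; apply: PB => //; apply: PN.
have pi0 : pi 0 = 0 by rewrite -[X in pi X](subrr 0) piD piN subrr.
rewrite -[u]freeg_sumE; elim/big_ind: _ => [|y z Py Pz|am _].
- by rewrite pi0.
- by rewrite piD; apply: PD.
have PM n : P (pi (<< am >> *+ n)).
  elim: n => [|n IH]; first by rewrite mulr0n pi0.
  by rewrite mulrS piD; apply: PD => //; case: am {IH} => a m; apply: Pt.
case: (coeff _ _) => n.
- by have := PM n; rewrite freegU_muln natz.
- by have := PN _ (PM n.+1); rewrite -piN freegU_muln natz freegUN -NegzE.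
Qed.

End Tensor.

Arguments tens {R A M}.

Section TensorMap.
Variables (R : pzRingType) (A A' : rmodType R) (M M' : lmodType R).
Variables (f : {linear A -> A'}) (g : {linear M -> M'}).

(* The map f (x) g. *)
Definition tensor_map : tensor A M -> tensor A' M' :=
  tensor_lift (fun a m => tens (f a) (g m)).

Lemma tensor_map_balanced :
  balanced (fun a m => tens (f a) (g m) : tensor A' M').
Proof.
case: (tens_balanced A' M') => Dl Dr Z.
split=> [a a' m|a m m'|a r m]; rewrite ?raddfD ?Dl ?Dr //.
by rewrite /ract !linearZ -Z.
Qed.

Lemma tensor_mapE a m : tensor_map (tens a m) = tens (f a) (g m).
Proof. exact: (tensor_liftE tensor_map_balanced). Qed.

HB.instance Definition _ := GRing.isZmodMorphism.Build _ _ tensor_map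
  (tensor_lift_additive tensor_map_balanced).

End TensorMap.

(* ------------------------------------------------------------------------ *)

Definition surjective (U V : Type) (f : U -> V) : Prop :=
  forall y, exists x, f x = y.

(* Exactness of  U --f--> V --g--> W  at V. *)
Definition exact_at (U : Type) (V W : zmodType) (f : U -> V) (g : V -> W) :
    Prop :=
  forall y, g y = 0 <-> exists x, f x = y.

(* i identifies U with Ker d. *)
Definition kernel_of (U V W : zmodType) (i : U -> V) (d : V -> W) : Prop :=
  injective i /\ exact_at i d.

Definition short_exact (U V W : zmodType) (i : U -> V) (p : V -> W) : Prop :=
  [/\ injective i, exact_at i p & surjective p].

Section Modules.
Variable S : pzRingType.

Definition finitely_generated (P : lmodType S) : Prop :=
  exists (n : nat) (e : 'I_n -> P),
    forall x, exists c : 'I_n -> S, x = \sum_(i < n) c i *: e i.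

Definition projective (P : lmodType S) : Prop :=
  forall (M N : lmodType S) (p : {linear M -> N}) (f : {linear P -> N}),
    surjective p -> exists h : {linear P -> M}, forall x, p (h x) = f x.

(* ... -> P 2 -> P 1 -> P 0 -> M -> 0 is exact; d n goes from P (n+1) to P n
   and e is the augmentation. *)
Definition resolution (P : nat -> lmodType S) (M : lmodType S)
    (d : forall n, {linear P n.+1 -> P n}) (e : {linear P 0 -> M}) : Prop :=
  [/\ surjective e, exact_at (d 0) e & forall n, exact_at (d n.+1) (d n)].

Definition FP_infty (M : lmodType S) : Prop :=
  exists (P : nat -> lmodType S) (d : forall n, {linear P n.+1 -> P n})
         (e : {linear P 0 -> M}),
    resolution d e /\ forall n, finitely_generated (P n) /\ projective (P n).

(* Ext^1(M, N) = 0: for every projective resolution P of M the complex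
   Hom(P 0, N) -> Hom(P 1, N) -> Hom(P 2, N), whose maps are composition with
   d 0 and d 1, is exact in the middle. *)
Definition Ext1_eq0 (M N : lmodType S) : Prop :=
  forall (P : nat -> lmodType S) (d : forall n, {linear P n.+1 -> P n})
         (e : {linear P 0 -> M}),
    resolution d e -> (forall n, projective (P n)) ->
    forall g : {linear P 1 -> N}, (forall x, g (d 1 x) = 0) ->
    exists h : {linear P 0 -> N}, forall x, g x = h (d 0 x).

Definition direct_summand (M X : lmodType S) : Prop :=
  exists (N : lmodType S) (f : {linear (M * N)%type -> X}), bijective f.

Definition closed_under_extensions (C : lmodType S -> Prop) : Prop :=
  forall (M' M M'' : lmodType S)
         (i : {linear M' -> M}) (p : {linear M -> M''}),
    short_exact i p -> C M' -> C M'' -> C M.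

End Modules.

Section GorensteinACFlat.
Variable R : pzRingType.

Definition flat (F : lmodType R) : Prop :=
  forall (A B : rmodType R) (f : {linear A -> B}),
    injective f -> injective (tensor_map f (idfun : {linear F -> F})).

Definition absolutely_clean (A : rmodType R) : Prop :=
  forall F : rmodType R, FP_infty F -> Ext1_eq0 F A.

(* An exact complex ... -> F (n+1) -> F n -> ... of flat modules indexed by
   the integers, d n going from F (n+1) to F n, that stays exact after
   tensoring with any absolutely clean right module. *)
Definition AC_acyclic_flat_complex (F : int -> lmodType R)
    (d : forall n : int, {linear F (n + 1) -> F n}) : Prop :=
  [/\ forall n, flat (F n),
      forall n, exact_at (d (n + 1)) (d n)
    & forall A : rmodType R, absolutely_clean A ->
      forall n, exact_at (tensor_map (idfun : {linear A -> A}) (d (n + 1)))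
                         (tensor_map (idfun : {linear A -> A}) (d n))].

Definition gorenstein_AC_flat (M : lmodType R) : Prop :=
  exists (F : int -> lmodType R) (d : forall n : int, {linear F (n + 1) -> F n})
         (n : int) (i : {linear M -> F (n + 1)}),
    AC_acyclic_flat_complex d /\ kernel_of i (d n).

Definition strongly_gorenstein_AC_flat (M : lmodType R) : Prop :=
  exists (F : lmodType R) (d : {linear F -> F}) (i : {linear M -> F}),
    @AC_acyclic_flat_complex (fun=> F) (fun=> d) /\ kernel_of i d.

End GorensteinACFlat.

(* Main.v *)
Require Import Defs.
From HB Require Import structures.
From mathcomp Require Import all_boot ssralg ssrint.
From mathcomp Require Import generic_quotient ring_quotient boolp.

(** Call a short exact sequence 0 -> K -> P -> M -> 0 with P flat a pure step
    from M to K when A (x) K -> A (x) P stays injective for every absolutely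
    clean A. Cutting a complex at its cycles and splicing it back shows that
    the Gorenstein AC-flat modules form the largest class C such that each M
    in C admits a pure step to some K in C and is itself reached by a pure
    step from some D in C (gorenstein_left and gorenstein_right,
    gorenstein_AC_flat_coind). In this form the notion can be checked one step
    at a time, and no derived functor is needed: purity of a step is all that
    is ever used about Tor.

    If M is Gorenstein AC-flat, a cycle of F say, then the direct sum of all
    the shifts of F is a complex with one term, the sum S of all F n, and one
    differential. Tensor products commute with direct sums, so it inherits
    flatness and exactness from F, and M is a summand of its cycle module
    (gorenstein_summand_strongly).

    Conversely let C be the class of retracts of Gorenstein AC-flat modules,
    and let M, with j : M -> X and r : X -> M, be a retract of such an X.
    Choose pure steps 0 -> X1 -> P -> X -> 0 and 0 -> X -> F -> X' -> 0 with
    X1 and X' Gorenstein AC-flat. The composites P -> X -> M and M -> X -> F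
    give steps with K = Ker (P -> M) and D = F / M. These need not be
    Gorenstein AC-flat, but there are exact sequences
      0 -> X1 -> K x M -> X -> 0   and   0 -> X -> D x M -> X' -> 0,
    so that closure under extensions makes K x M and D x M Gorenstein AC-flat,
    whence K and D lie in C. Hence C satisfies the characterization above
    (retract_left, retract_right, gorenstein_retract). *)

Set Implicit Arguments.
Unset Strict Implicit.
Unset Printing Implicit Defensive.

Import GRing.Theory.
Local Open Scope ring_scope.
Local Open Scope quotient_scope.

(** * Linear maps, submodules and quotients *)
Section LinearMaps.
Variable R : pzRingType.
Implicit Types U V W : lmodType R.

(** Maps that are determined by a property of their values, rather than given
    by a formula, are obtained from their graph: if the relation is compatible
    with the operations, it is single-valued as soon as it is so at 0. *)
Lemma linear_of_rel U V (G : U -> V -> Prop) :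
    (forall u, exists v, G u v) -> (forall v, G 0 v -> v = 0) ->
    (forall a u u' v v', G u v -> G u' v' -> G (a *: u + u') (a *: v + v')) ->
  exists f : {linear U -> V}, forall u, G u (f u).
Proof.
move=> tot G0 Glin; have [f fG] := choice tot.
have f_lin : linear f.
  move=> a u u'; apply/eqP; rewrite -subr_eq0; apply/eqP/G0.
  have -> : (0 : U) = (-1) *: (a *: u + u') + (a *: u + u').
    by rewrite scaleN1r addNr.
  rewrite -opprB -scaleN1r -[X in G _ X]addr0.
  have -> : (-1) *: (a *: f u + f u' - f (a *: u + u')) + 0 =
            (-1) *: (a *: f u + f u') + f (a *: u + u').
    by rewrite !scaleN1r opprB addr0 addrC.
  by apply: (Glin); first exact: Glin.
pose L := GRing.isLinear.Build R U V *:%R f f_lin.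
pose F : {linear U -> V} := HB.pack f L.
by exists F.
Qed.

Lemma factor_inj U V W (i : {linear V -> W}) (f : {linear U -> W}) :
    injective i -> (forall u, exists v, i v = f u) ->
  exists g : {linear U -> V}, forall u, i (g u) = f u.
Proof.
move=> i_inj fi; apply: (@linear_of_rel _ _ (fun u v => i v = f u)) => //.
  by move=> v; rewrite linear0 => iv; apply: i_inj; rewrite linear0.
by move=> a u u' v v' e e'; rewrite !linearP e e'.
Qed.

Lemma factor_surj U V W (p : {linear U -> V}) (f : {linear U -> W}) :
    surjective p -> (forall u, p u = 0 -> f u = 0) ->
  exists g : {linear V -> W}, forall u, g (p u) = f u.
Proof.
move=> p_surj pf.
have [|v [u [pu <-]]||g gP] := @linear_of_rel _ _
    (fun v w => exists u, p u = v /\ f u = w).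
- by move=> v; have [u pu] := p_surj v; exists (f u), u.
- exact: pf.
- move=> a v v' w w' [u [<- <-]] [u' [<- <-]].
  by exists (a *: u + u'); rewrite !linearP.
exists g => u; have [u' [pu' <-]] := gP (p u).
by apply/eqP; rewrite -subr_eq0 -linearB pf // linearB pu' subrr.
Qed.

Lemma submodule_ex V (P : V -> Prop) :
    P 0 -> (forall a u v, P u -> P v -> P (a *: u + v)) ->
  exists (K : lmodType R) (i : {linear K -> V}),
    injective i /\ forall v, P v <-> exists k, i k = v.
Proof.
move=> P0 Plin.
pose S : {pred V} := fun v => `[< P v >].
have S_closed : submod_closed S.
  by split=> [|a u v /asboolP Pu /asboolP Pv]; apply/asboolP => //; apply: Plin.
pose L := GRing.isSubmodClosed.Build R V S S_closed.
pose SC : submodClosed V := HB.pack S L.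
pose T := {x : V | x \in SC}.
pose Z := [SubChoice_isSubLmodule of T by <:].
pose K : subLmodType (fun x => x \in SC) := HB.pack T Z.
exists K, (val : {linear K -> V}); split; first exact: val_inj.
move=> v; split=> [Pv|[k <-]]; last by have /asboolP := valP k.
have Sv : v \in S by apply/asboolP.
by exists (Sub v Sv : K); exact: (SubK K Sv).
Qed.

Lemma kernel_ex U V (f : {linear U -> V}) :
  exists (K : lmodType R) (i : {linear K -> U}), kernel_of i f.
Proof.
have [||K [i [i_inj iP]]] := @submodule_ex U (fun u => f u = 0).
- exact: linear0.
- by move=> a u v fu fv; rewrite linearP fu fv scaler0 addr0.
by exists K, i.
Qed.

End LinearMaps.

Lemma coker_ex (U V : zmodType) (f : {additive U -> V}) :
  exists (Q : zmodType) (p : {additive V -> Q}), surjective p /\ exact_at f p.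
Proof.
pose I : {pred V} := fun v => `[< exists u, f u = v >].
have I_closed : zmod_closed I.
  split=> [|_ _ /asboolP[u <-] /asboolP[v <-]]; apply/asboolP.
    by exists 0; rewrite raddf0.
  by exists (u - v); rewrite raddfB.
pose L := GRing.isZmodClosed.Build V I I_closed.
pose IC : zmodClosed V := HB.pack I L.
pose Q := Quotient.quot IC; pose p (v : V) : Q := \pi_Q v.
have p_add : zmod_morphism p.
  by move=> u v; rewrite /p /= (Quotient.pi_add IC) (Quotient.pi_opp IC).
pose pL := GRing.isZmodMorphism.Build V Q p p_add.
pose pA : {additive V -> Q} := HB.pack p pL.
exists Q, pA; split=> [q|v]; first by exists (repr q); rewrite /= /p reprK.
have -> : (pA v = 0) = (v \in IC : Prop).
  rewrite -[v in RHS]subr0 Quotient.idealrBE -(raddf0 pA).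
  by apply/propext; split=> /eqP.
by split=> /asboolP.
Qed.

(** The action on the cokernel is transported along a section s of p; it is
    independent of the choice because the image of f is a submodule. *)
Lemma lcoker_ex (R : pzRingType) (U V : lmodType R) (f : {linear U -> V}) :
  exists (Q : lmodType R) (p : {linear V -> Q}), surjective p /\ exact_at f p.
Proof.
have [[T cT] [p [p_surj p_ex]]] := coker_ex f.
pose Q := GRing.Zmodule.Pack cT.
have [s sK] := choice p_surj.
pose sc (a : R) (q : Q) : Q := p (a *: s q).
have scE a v : sc a (p v) = p (a *: v).
  apply/eqP; rewrite -subr_eq0 -raddfB -scalerBr; apply/eqP.
  have /p_ex[u fu] : p (s (p v) - v) = 0 by rewrite raddfB sK subrr.
  by apply/p_ex; exists (a *: u); rewrite -fu; exact: (linearZ_LR f).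
have scA a b q : sc a (sc b q) = sc (a * b) q.
  by have [v <-] := p_surj q; rewrite !scE scalerA.
have sc1 : left_id 1 sc.
  by move=> q; have [v <-] := p_surj q; rewrite !scE scale1r.
have scDr : right_distributive sc +%R.
  move=> a q r; have [v <-] := p_surj q; have [w <-] := p_surj r.
  by rewrite -raddfD !scE scalerDr raddfD.
have scDl q : {morph sc^~ q : a b / a + b}.
  by move=> a b; have [v <-] := p_surj q; rewrite !scE scalerDl raddfD.
pose QL := GRing.Zmodule_isLmodule.Build R Q scA sc1 scDr scDl.
pose Q' : lmodType R := HB.pack T cT QL.
have p_lin : linear (p : V -> Q').
  by move=> a u v; rewrite raddfD /= -scE.
pose pL := GRing.isLinear.Build R V Q' *:%R p p_lin.
pose p' : {linear V -> Q'} := HB.pack (p : V -> Q') pL.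
by exists Q', p'.
Qed.

(** * Tensor products *)
Local Notation tensr A g := (tensor_map (idfun : {linear A -> A}) g).

Section TensorTheory.
Variable R : pzRingType.
Implicit Types (A : rmodType R) (M N U V W : lmodType R).

Lemma tensor_mapB A A' M M' (f : {linear A -> A'}) (g : {linear M -> M'}) :
  {morph tensor_map f g : x y / x - y}.
Proof. by move=> x y; rewrite raddfB. Qed.

Lemma tensor_map_comp A A' A'' M M' M''
    (f : {linear A -> A'}) (f' : {linear A' -> A''}) (f'' : {linear A -> A''})
    (g : {linear M -> M'}) (g' : {linear M' -> M''}) (g'' : {linear M -> M''}) :
    (forall a, f'' a = f' (f a)) -> (forall m, g'' m = g' (g m)) ->
  forall t, tensor_map f'' g'' t = tensor_map f' g' (tensor_map f g t).
Proof.
move=> fE gE; elim/tensor_ind => [x y ex ey|a m].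
  by rewrite !tensor_mapB ex ey.
by rewrite !tensor_mapE fE gE.
Qed.

Lemma tensr_id A M (g : {linear M -> M}) :
  (forall m, g m = m) -> forall t, tensr A g t = t.
Proof.
move=> gE; elim/tensor_ind => [x y ex ey|a m].
  by rewrite !tensor_mapB ex ey.
by rewrite tensor_mapE gE.
Qed.

Lemma tensr_comp A M M' M''
    (g : {linear M -> M'}) (g' : {linear M' -> M''}) (g'' : {linear M -> M''}) :
    (forall m, g'' m = g' (g m)) ->
  forall t, tensr A g'' t = tensr A g' (tensr A g t).
Proof. exact: tensor_map_comp. Qed.

Lemma tensr_square A M N N' M'
    (g : {linear M -> N}) (g' : {linear N -> M'})
    (h : {linear M -> N'}) (h' : {linear N' -> M'}) :
    (forall m, g' (g m) = h' (h m)) ->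
  forall t, tensr A g' (tensr A g t) = tensr A h' (tensr A h t).
Proof.
move=> gh t; rewrite -(tensr_comp (g'' := g' \o g)) //.
by apply: tensr_comp => m; exact: gh.
Qed.

Lemma tens0r A M (a : A) : tens a 0 = 0 :> tensor A M.
Proof.
have [_ Dr _] := tens_balanced A M.
by apply: (@addrI _ (tens a 0)); rewrite -Dr !addr0.
Qed.

Lemma tens_sumr A M (I : Type) (s : seq I) (f : I -> M) (a : A) :
  tens a (\sum_(i <- s) f i) = \sum_(i <- s) tens a (f i).
Proof.
have [_ Dr _] := tens_balanced A M.
exact: (big_morph (tens a) (Dr a) (tens0r M a)).
Qed.

Lemma tensr0 A M M' (g : {linear M -> M'}) :
  (forall m, g m = 0) -> forall t, tensr A g t = 0.
Proof.
move=> gE.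
elim/tensor_ind => [x y ex ey|a m]; first by rewrite tensor_mapB ex ey subrr.
by rewrite tensor_mapE gE tens0r.
Qed.

Lemma tensr_surj A M M' (g : {linear M -> M'}) :
  surjective g -> surjective (tensr A g).
Proof.
move=> g_surj; elim/tensor_ind => [_ _ [x <-] [y <-]|a m'].
  by exists (x - y); rewrite tensor_mapB.
by have [m <-] := g_surj m'; exists (tens a m); rewrite tensor_mapE.
Qed.

(** Right exactness. With q the cokernel of A (x) i, the map a (x) w |->
    q (a (x) v), for any v over w, is well defined on A (x) W. It factors q
    through A (x) p, so whatever A (x) p kills dies in the cokernel. *)
Lemma tensr_exact A U V W (i : {linear U -> V}) (p : {linear V -> W}) :
    exact_at i p -> surjective p ->
  exact_at (tensr A i) (tensr A p).
Proof.
move=> ip p_surj.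
have [Q [q [q_surj iq]]] := coker_ex (tensr A i).
have [s sK] := choice p_surj.
have [Dl Dr Z] := tens_balanced A V.
have qE a v v' : p v = p v' -> q (tens a v) = q (tens a v').
  move=> pE; have /ip[u iu] : p (v' - v) = 0 by rewrite linearB pE subrr.
  have -> : v' = v + (v' - v) by rewrite addrC subrK.
  rewrite Dr raddfD -iu [X in _ + X](_ : _ = 0) ?addr0 //.
  by apply/iq; exists (tens a u); exact: tensor_mapE.
have b : balanced (fun (a : A) w => q (tens a (s w))).
  split=> [a a' m|a m m'|a r m]; first by rewrite Dl raddfD.
    by rewrite -raddfD -Dr; apply: qE; rewrite sK linearD !sK.
  by rewrite Z; apply: qE; rewrite sK linearZ_LR sK.
pose h := tensor_lift (fun (a : A) w => q (tens a (s w))).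
have hB : zmod_morphism h := tensor_lift_additive b.
pose hL := GRing.isZmodMorphism.Build _ _ h hB.
pose H : {additive tensor A W -> Q} := HB.pack h hL.
have HE t : H (tensr A p t) = q t.
  elim/tensor_ind: t => [x y ex ey|a m].
    by rewrite tensor_mapB !raddfB ex ey.
  by rewrite tensor_mapE /= /h tensor_liftE //; apply: qE; rewrite sK.
move=> t; split=> [pt|[u <-]]; first by apply/iq; rewrite -HE pt raddf0.
pose z : {linear U -> W} := (p \o i).
rewrite -(tensr_comp (g'' := z)) // tensr0 // => m.
by apply/ip; exists m.
Qed.
End TensorTheory.

(** * Pure short exact sequences and splicing *)
Section Splicing.
Variable R : pzRingType.
Implicit Types K M N P X : lmodType R.

(** As the middle term is flat, step_pure amounts to Tor_1(A, M) = 0 for every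
    absolutely clean A. *)
Record pure_step K M : Type := PureStep {
  mid : lmodType R;
  inc : {linear K -> mid};
  proj : {linear mid -> M};
  mid_flat : flat mid;
  step_exact : short_exact inc proj;
  step_pure : forall A : rmodType R,
    absolutely_clean A -> injective (tensr A inc)
}.

(** Stated for additive groups so that it applies to a complex and to its
    tensor product with A alike. *)
Lemma splice_exact (U : Type) (K : Type) (V M W : zmodType)
    (q : U -> K) (i : K -> V) (p : V -> M) (j : {additive M -> W})
    (f : U -> V) (g : V -> W) :
    surjective q -> exact_at i p -> injective j ->
    (forall u, f u = i (q u)) -> (forall v, g v = j (p v)) ->
  exact_at f g.
Proof.
move=> q_surj ip j_inj fE gE v; rewrite gE; split=> [|[u <-]].
  rewrite -(raddf0 j) => /j_inj/ip[k <-].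
  by have [u <-] := q_surj k; exists u.
have -> : p (f u) = 0 by apply/ip; exists (q u).
exact: raddf0.
Qed.

(** The middle terms of consecutive steps form the complex, with differential
    P (n + 1) -> Z (n + 1) -> P n. With this numbering no term has to be
    transported along an equality of integers. *)
Lemma splice (Z : int -> lmodType R)
    (S : forall n, pure_step (Z (n + 1)) (Z n)) :
  forall n, gorenstein_AC_flat (Z n).
Proof.
pose F n := mid (S n).
pose d n : {linear F (n + 1) -> F n} := (inc (S n) \o proj (S (n + 1))).
have dF : AC_acyclic_flat_complex d.
  split=> [n|n|A cA n]; first exact: mid_flat.
    have [_ _ q_surj] := step_exact (S (n + 1 + 1)).
    have [_ ip _] := step_exact (S (n + 1)).
    have [j_inj _ _] := step_exact (S n).
    exact: (splice_exact q_surj ip j_inj).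
  have [_ _ q_surj] := step_exact (S (n + 1 + 1)).
  have [_ ip p_surj] := step_exact (S (n + 1)).
  apply: (splice_exact (j := tensr A (inc (S n)))
            (tensr_surj (A := A) q_surj) (tensr_exact (A := A) ip p_surj)).
  - exact: step_pure.
  - exact: tensr_comp.
  - exact: tensr_comp.
have ker n : kernel_of (inc (S (n + 1))) (d n).
  have [i_inj ip _] := step_exact (S (n + 1)); split=> //.
  have [j_inj _ _] := step_exact (S n).
  apply: (splice_exact (q := id) _ ip j_inj) => // z; by exists z.
(* Z (m + 1 + 1) is the kernel of d m *)
move=> n; have -> : n = n - 1 - 1 + 1 + 1 by rewrite !subrK.
by exists F, d, (n - 1 - 1), (inc (S (n - 1 - 1 + 1))).
Qed.

(** Starting from M, iterate the two choices of steps to the left and to the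
    right; the resulting sequence of modules indexed by the integers splices. *)
Lemma gorenstein_AC_flat_coind (C : lmodType R -> Prop) :
    (forall M, C M -> exists K, C K /\ inhabited (pure_step K M)) ->
    (forall M, C M -> exists D, C D /\ inhabited (pure_step M D)) ->
  forall M, C M -> gorenstein_AC_flat M.
Proof.
move=> left right M CM.
pose T := {N : lmodType R | C N}; pose t : T := exist _ M CM.
have /choice[l lP] (N : T) :
    exists K : T, inhabited (pure_step (sval K) (sval N)).
  have [K [CK ?]] := left _ (svalP N); by exists (exist _ K CK).
have /choice[r rP] (N : T) :
    exists D : T, inhabited (pure_step (sval N) (sval D)).
  have [D [CD ?]] := right _ (svalP N); by exists (exist _ D CD).
pose Z (n : int) : T :=
  match n with Posz k => iter k l t | Negz k => iter k.+1 r t end.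
have ZS n : inhabited (pure_step (sval (Z (n + 1))) (sval (Z n))).
  case: n => [k|[|k]]; first by rewrite -PoszD addn1; apply: lP.
    exact: rP t.
  have -> : Negz k.+1 + 1 = Negz k by rewrite !NegzE -addn1 PoszD opprD subrK.
  exact: rP.
have S n : pure_step (sval (Z (n + 1))) (sval (Z n)).
  suff /cid[s _] : exists s : pure_step (sval (Z (n + 1))) (sval (Z n)), True.
    exact: s.
  by case: (ZS n) => s; exists s.
exact: (splice S 0).
Qed.

Section Cycles.
Variables (F : int -> lmodType R) (d : forall n, {linear F (n + 1) -> F n}).
Hypothesis dF : AC_acyclic_flat_complex d.

Lemma factor_cycle M n (i : {linear M -> F (n + 1)}) :
    kernel_of i (d n) ->
  exists q : {linear F (n + 1 + 1) -> M},
    (forall x, i (q x) = d (n + 1) x) /\ surjective q.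
Proof.
case: dF => _ ex _ [i_inj iker].
have [x|q qE] := factor_inj (f := d (n + 1)) i_inj.
  by apply/iker/ex; exists x.
exists q; split=> // m; have /ex[x dx] : d n (i m) = 0 by apply/iker; exists m.
by exists x; apply: i_inj; rewrite qE.
Qed.

(** An element t of A (x) M comes from some w in A (x) F (n + 2). If t dies in
    A (x) F (n + 1), then w is a cycle, hence a boundary, and boundaries vanish
    in M. *)
Lemma cycle_pure (A : rmodType R) M n (i : {linear M -> F (n + 1)}) :
  absolutely_clean A -> kernel_of i (d n) -> injective (tensr A i).
Proof.
case: (dF) => _ ex texact cA iker; have [q [qE q_surj]] := factor_cycle iker.
apply: raddf_inj => t it0; have [w wE] := tensr_surj (A := A) q_surj t.
have /texact-/(_ cA)[v vE] : tensr A (d (n + 1)) w = 0.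
  by rewrite (tensr_comp (g := q) (g' := i)) ?wE.
pose z : {linear F (n + 1 + 1 + 1) -> M} := q \o d (n + 1 + 1).
rewrite -wE -vE -(tensr_comp (g'' := z)) // tensr0 // => x.
case: iker => i_inj _; apply: i_inj; rewrite linear0 qE.
by apply/ex; exists x.
Qed.

Lemma cycle_step M (D : lmodType R) n (i : {linear M -> F (n + 1 + 1)})
    (k : {linear D -> F (n + 1)}) :
  kernel_of i (d (n + 1)) -> kernel_of k (d n) -> inhabited (pure_step M D).
Proof.
move=> iker kker; have [q [qE q_surj]] := factor_cycle kker.
have [F_flat _ _] := dF; have [i_inj i_ex] := iker.
split; apply: (@PureStep M D _ i q); first exact: F_flat.
  split=> // y; rewrite -i_ex -qE; split=> [->|]; first exact: linear0.
  by case: kker => k_inj _; rewrite -(linear0 k) => /k_inj.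
by move=> A cA; exact: cycle_pure iker.
Qed.
End Cycles.

Lemma gorenstein_left M : gorenstein_AC_flat M ->
  exists K, gorenstein_AC_flat K /\ inhabited (pure_step K M).
Proof.
case=> F [d [n [i [dF iker]]]].
have [K [k kker]] := kernel_ex (d (n + 1)).
exists K; split; last exact: cycle_step kker iker.
by exists F, d, (n + 1), k.
Qed.

Lemma gorenstein_right M : gorenstein_AC_flat M ->
  exists D, gorenstein_AC_flat D /\ inhabited (pure_step M D).
Proof.
case=> F [d [n]]; rewrite -[n](subrK 1) => - [i [dF iker]].
have [D [k kker]] := kernel_ex (d (n - 1)).
exists D; split; last exact: cycle_step iker kker.
by exists F, d, (n - 1), k.
Qed.

End Splicing.

(** * Direct summands *)
Section Retracts.
Variable R : pzRingType.
Implicit Types M N X : lmodType R.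

Definition retract M X : Prop :=
  exists (j : {linear M -> X}) (r : {linear X -> M}), cancel j r.

Lemma pair_linear_ex (U V W : lmodType R)
    (f : {linear U -> V}) (g : {linear U -> W}) :
  exists h : {linear U -> (V * W)%type}, forall u, h u = (f u, g u).
Proof.
have [u|v|a u u' v v' -> ->|h hE] := @linear_of_rel _ U (V * W)%type
    (fun u vw => vw = (f u, g u)).
- by exists (f u, g u).
- by rewrite !linear0.
- by rewrite !linearP.
by exists h.
Qed.

(** The complement of a retract is the kernel of the retraction. *)
Lemma direct_summandP M X : direct_summand M X <-> retract M X.
Proof.
split=> [[N [f [g fK gK]]]|[j [r jK]]].
  have [h hE] :=
    pair_linear_ex (idfun : {linear M -> M}) (\0 : {linear M -> N}).
  pose pr1 : {linear (M * N)%type -> M} := fst.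
  have [x|u fu|r rE] := factor_surj (p := f) (f := pr1).
  - by exists (g x).
  - by rewrite -[u]fK fu -(linear0 f) fK.
  by exists (f \o h), r => m; rewrite /= rE hE.
have [N [k [k_inj kker]]] := kernel_ex r.
have rk n : r (k n) = 0 by apply/kker; exists n.
pose f : {linear (M * N)%type -> X} := (j \o fst) \+ (k \o snd).
have fE m n : f (m, n) = j m + k n by [].
have f_surj x : exists u, f u = x.
  have /kker[n kn] : r (x - j (r x)) = 0 by rewrite linearB jK subrr.
  by exists (r x, n); rewrite fE kn addrC subrK.
have [g gK] := choice f_surj.
have f_inj : injective f.
  move=> [m n] [m' n']; rewrite !fE => e.
  have em : m = m' by have := congr1 r e; rewrite !linearD !jK !rk !addr0.
  by move: e; rewrite em => /addrI/k_inj->.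
by exists N, f; exists g => // u; apply: f_inj; rewrite gK.
Qed.

Hypothesis extP : closed_under_extensions (@gorenstein_AC_flat R).

(** For a pure step X -> F -> X' the module D = F / j(M) is a retract of D x M,
    which is an extension of X' by X: the map X -> D x M is x |-> ([u x], r x)
    and D x M -> X' sends ([y], m) to v y. Purity of M -> F is inherited from
    the split injection j and from X -> F. *)
Lemma retract_right M X : retract M X -> gorenstein_AC_flat X ->
  exists D, (exists Y, gorenstein_AC_flat Y /\ retract D Y) /\
            inhabited (pure_step M D).
Proof.
move=> [j [r jK]] GX.
have [X' [GX' [[F u v F_flat [u_inj uv v_surj] u_pure]]]] :=
  gorenstein_right GX.
pose w : {linear M -> F} := u \o j.
have [D [p [p_surj wp]]] := lcoker_ex w.
exists D; split; last first.
  split; apply: (@PureStep _ _ _ _ w p) => //.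
    by split=> // m m' /u_inj/(can_inj jK).
  move=> A cA s t; rewrite !(tensr_comp (g := j) (g' := u) (g'' := w)) //.
  move=> /(u_pure _ cA) e.
  have rj s0 : tensr A r (tensr A j s0) = s0.
    by rewrite -(tensr_comp (g'' := r \o j)) // tensr_id.
  by rewrite -[s]rj e rj.
have [y|b bE] := factor_surj (f := v) p_surj.
  by move=> /wp[m <-]; apply/uv; exists (j m).
have [a aE] := pair_linear_ex (p \o u) r.
have [c cE] := pair_linear_ex (idfun : {linear D -> D}) (\0 : {linear D -> M}).
exists (D * M)%type; split; last by exists c, fst => x; rewrite cE.
apply: (extP (i := a) (p := b \o fst)) => //; split.
- apply: raddf_inj => x /=; rewrite aE => -[/wp[m /u_inj <-]].
  by rewrite jK => ->; rewrite linear0.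
- move=> [q m]; have [y <-] := p_surj q; rewrite /= bE; split.
    (* j M is in the kernel of X -> F -> D, so x can be corrected to hit m *)
    case/uv=> x <-; exists (x + j (m - r x)); rewrite aE; congr pair.
      have pw0 : p (u (j (m - r x))) = 0 by apply/wp; exists (m - r x).
      by rewrite [LHS]/= (linearD u) (linearD p) pw0 addr0.
    by rewrite (linearD r) (jK (m - r x)) addrC subrK.
  by case=> x; rewrite aE => -[e _]; rewrite -bE -e bE; apply/uv; exists x.
- by move=> x; have [y vy] := v_surj x; exists (p y, 0); rewrite /= bE.
Qed.

(** For a pure step X1 -> P -> X and K the kernel of P -> X -> M, the module
    K x M is an extension of X by X1: K x M -> X is (k, m) |-> v k + j m.
    The same sequence gives purity of K -> P. If t in A (x) K dies in A (x) P,
    its image in A (x) (K x M) dies in A (x) X, so by right exactness it comes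
    from some s in A (x) X1; as s dies in A (x) P, it is zero. *)
Lemma retract_left M X : retract M X -> gorenstein_AC_flat X ->
  exists K, (exists Y, gorenstein_AC_flat Y /\ retract K Y) /\
            inhabited (pure_step K M).
Proof.
move=> [j [r jK]] GX.
have [X1 [GX1 [[P u v P_flat [u_inj uv v_surj] u_pure]]]] := gorenstein_left GX.
pose w : {linear P -> M} := r \o v.
have [K [k [k_inj kw]]] := kernel_ex w.
have vu x : v (u x) = 0 by apply/uv; exists x.
have [x|l lE] := factor_inj (f := u) k_inj.
  by apply/kw; rewrite /= vu linear0.
have [a aE] := pair_linear_ex l (\0 : {linear X1 -> M}).
have [c cE] := pair_linear_ex (idfun : {linear K -> K}) (\0 : {linear K -> M}).
pose b : {linear (K * M)%type -> X} := ((v \o k) \o fst) \+ (j \o snd).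
have bE x m : b (x, m) = v (k x) + j m by [].
have rvk x : r (v (k x)) = 0 by apply: (proj2 (kw (k x))); exists x.
have ab : exact_at a b.
  move=> [x m]; rewrite bE; split=> [e|[y]]; last first.
    by rewrite aE => -[<- <-]; rewrite lE vu linear0 addr0.
  have m0 : m = 0 by have := congr1 r e; rewrite linearD rvk jK add0r linear0.
  move: e; rewrite m0 linear0 addr0 => /uv[y uy].
  by exists y; rewrite aE; congr pair; apply: k_inj; rewrite lE.
have b_surj : surjective b.
  move=> x; have [y vy] := v_surj (x - j (r x)).
  have /kw[z kz] : w y = 0 by rewrite /= vy linearB jK subrr.
  by exists (z, r x); rewrite bE kz vy subrK.
exists K; split.
  exists (K * M)%type; split; last by exists c, fst => x; rewrite cE.
  apply: (extP (i := a) (p := b)) => //; split=> //.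
  by move=> x y; rewrite !aE => -[e]; apply: u_inj; rewrite -!lE e.
split; apply: (@PureStep _ _ _ _ k w) => //.
  split=> // m; have [y vy] := v_surj (j m).
  by exists y; rewrite /= vy.
move=> A cA; apply: raddf_inj => t kt0.
have bct0 : tensr A b (tensr A c t) = 0.
  rewrite -(tensr_comp (g'' := v \o k)); last first.
    by move=> x; rewrite cE bE /= linear0 addr0.
  by rewrite (tensr_comp (g := k) (g' := v)) // kt0 raddf0.
have [s sE] := proj1 (tensr_exact (A := A) ab b_surj _) bct0.
have tE : tensr A l s = t.
  rewrite (tensr_comp (g := a) (g' := fst)); last by move=> x; rewrite aE.
  rewrite sE -(tensr_comp (g'' := idfun)); last by move=> x; rewrite cE.
  exact: tensr_id.
suff s0 : s = 0 by rewrite -tE s0 raddf0.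
apply: (u_pure A cA); rewrite raddf0 -kt0 -tE.
by apply: tensr_comp => x; rewrite lE.
Qed.

Lemma gorenstein_retract M X :
  retract M X -> gorenstein_AC_flat X -> gorenstein_AC_flat M.
Proof.
move=> MX GX.
apply: (@gorenstein_AC_flat_coind _
         (fun N => exists Y, gorenstein_AC_flat Y /\ retract N Y)).
- by move=> N [Y [GY NY]]; exact: retract_left NY GY.
- by move=> N [Y [GY NY]]; exact: retract_right NY GY.
by exists X.
Qed.

End Retracts.

(** * Direct sums *)
Section Product.
Variables (R : pzRingType) (I : Type) (F : I -> lmodType R).

Definition product : Type := forall i, F i.

HB.instance Definition _ := gen_eqMixin product.
HB.instance Definition _ := gen_choiceMixin product.

Implicit Types f g h : product.

Let add f g : product := fun i => f i + g i.
Let opp f : product := fun i => - f i.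
Let zero : product := fun i => 0.
Let scale (a : R) f : product := fun i => a *: f i.

Let addA : associative add.
Proof.
by move=> f g h; apply: functional_extensionality_dep => i; exact: addrA.
Qed.
Let addC : commutative add.
Proof.
by move=> f g; apply: functional_extensionality_dep => i; exact: addrC.
Qed.
Let add0 : left_id zero add.
Proof.
by move=> f; apply: functional_extensionality_dep => i; exact: add0r.
Qed.
Let addN : left_inverse zero opp add.
Proof.
by move=> f; apply: functional_extensionality_dep => i; exact: addNr.
Qed.

HB.instance Definition _ := GRing.isZmodule.Build product addA addC add0 addN.

Let scaleA a b f : scale a (scale b f) = scale (a * b) f.
Proof.
by apply: functional_extensionality_dep => i; exact: scalerA.
Qed.
Let scale1 : left_id 1 scale.
Proof.
by move=> f; apply: functional_extensionality_dep => i; exact: scale1r.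
Qed.
Let scaleDr : right_distributive scale +%R.
Proof.
by move=> a f g; apply: functional_extensionality_dep => i; exact: scalerDr.
Qed.
Let scaleDl f : {morph scale^~ f : a b / a + b}.
Proof.
by move=> a b; apply: functional_extensionality_dep => i; exact: scalerDl.
Qed.

HB.instance Definition _ :=
  GRing.Zmodule_isLmodule.Build R product scaleA scale1 scaleDr scaleDl.

Definition coord i f : F i := f i.

Lemma coord_linear i : linear (coord i).
Proof. by []. Qed.

HB.instance Definition _ i :=
  GRing.isLinear.Build R product (F i) *:%R (coord i) (coord_linear i).
End Product.

Section DirectSum.
Variables (R : pzRingType) (I : eqType) (F : I -> lmodType R).

Definition finsupp (f : forall i, F i) : Prop :=
  exists s : seq I, forall i, i \notin s -> f i = 0.

(** A module with these projections is determined up to isomorphism: the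
    projections are jointly injective, and by dsum_finsupp every element is
    the finite sum of its components. *)
Record direct_sum : Type := DirectSum {
  dsum :> lmodType R;
  dinj : forall i, {linear F i -> dsum};
  dproj : forall i, {linear dsum -> F i};
  dinjK : forall i, cancel (dinj i) (dproj i);
  dproj_inj : forall i j x, i != j -> dproj j (dinj i x) = 0;
  dsum_ext : forall x, (forall i, dproj i x = 0) -> x = 0;
  dsum_finsupp : forall x, finsupp (fun i => dproj i x)
}.

Lemma direct_sum_ex : inhabited direct_sum.
Proof.
have [||S [k [k_inj kP]]] := @submodule_ex R (product F) finsupp.
- by exists [::].
- move=> a u v [s us] [t vt]; exists (s ++ t) => i.
  rewrite mem_cat negb_or => /andP[/us ui /vt vi].
  by rewrite -[LHS]/(a *: u i + v i) ui vi scaler0 addr0.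
pose pr i : {linear S -> F i} := coord i \o k.
have ext x : (forall i, pr i x = 0) -> x = 0.
  move=> x0; apply: k_inj; rewrite linear0.
  by apply: functional_extensionality_dep => i; exact: x0.
have inP i : exists u : {linear F i -> S},
    forall x j, pr j (u x) = dfwith (fun k => 0 : F k) x j.
  apply: (@linear_of_rel _ _ S
           (fun x y => forall j, pr j y = dfwith (fun k => 0 : F k) x j)).
  - move=> x; have /kP[y ky] : finsupp (dfwith (fun k => 0 : F k) x).
      by exists [:: i] => j; rewrite inE eq_sym => ij; exact: dfwith_out.
    by exists y => j; rewrite /= ky.
  - move=> y y0; apply: ext => j; rewrite y0.
    by case: dfwithP.
  - move=> a x x' y y' yE y'E j; rewrite linearP yE y'E.
    have [<-|ij] := eqVneq i j; first by rewrite !dfwith_in.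
    by rewrite !dfwith_out // scaler0 addr0.
pose u i := projT1 (cid (inP i)).
have uE i x j : pr j (u i x) = dfwith (fun k => 0 : F k) x j.
  exact: (projT2 (cid (inP i))).
split; apply: (@DirectSum S u pr) => //.
- by move=> i x; rewrite uE dfwith_in.
- by move=> i j x ij; rewrite uE dfwith_out.
- by move=> x; apply/kP; exists x.
Qed.

Variable S : direct_sum.

Lemma dproj_sum (s : seq I) (f : forall i, F i) j :
    uniq s -> (forall i, i \notin s -> f i = 0) ->
  dproj S j (\sum_(i <- s) dinj S i (f i)) = f j.
Proof.
move=> s_uniq f0; rewrite linear_sum; have [js|js] := boolP (j \in s).
  rewrite (bigD1_seq j) //= dinjK big1 ?addr0 // => i ij.
  exact: dproj_inj.
rewrite f0 // big1_seq // => i /= si; apply: dproj_inj.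
by apply: contraNneq js => <-.
Qed.

Lemma dsum_sumE (s : seq I) (x : S) :
    uniq s -> (forall i, i \notin s -> dproj S i x = 0) ->
  x = \sum_(i <- s) dinj S i (dproj S i x).
Proof.
move=> s_uniq x0; apply/eqP; rewrite -subr_eq0; apply/eqP/dsum_ext => j.
by rewrite linearB dproj_sum // subrr.
Qed.

(** A (x) S is the sum of its components A (x) F i. To be able to subtract two
    such decompositions, the induction shows that every large enough finite
    set of indices works. *)
Lemma tensor_dsum_sumE (A : rmodType R) (t : tensor A S) :
  exists s : seq I,
    t = \sum_(i <- s) tensr A (dinj S i) (tensr A (dproj S i) t).
Proof.
suff [s sE] : exists s : seq I, forall s', uniq s' -> {subset s <= s'} ->
    t = \sum_(i <- s') tensr A (dinj S i) (tensr A (dproj S i) t).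
  exists (undup s); apply: sE; first exact: undup_uniq.
  by move=> i; rewrite mem_undup.
elim/tensor_ind: t => [x y [s sE] [s' s'E]|a m].
  exists (s ++ s') => w w_uniq sw.
  have sub (r : seq I) : {subset r <= s ++ s'} -> {subset r <= w}.
    by move=> rs i /rs/sw.
  have xE := sE w w_uniq (sub s (mem_subseq (prefix_subseq _ _))).
  have yE := s'E w w_uniq (sub s' (mem_subseq (suffix_subseq _ _))).
  rewrite [in LHS]xE [in LHS]yE -sumrB; apply: eq_bigr => i _.
  by rewrite !tensor_mapB.
have [s ms] := dsum_finsupp m; exists s => s' s'_uniq ss'.
rewrite [in LHS](dsum_sumE (s := s') (x := m)) //; last first.
  by move=> i /(contra (ss' i))/ms.
by rewrite tens_sumr; apply: eq_bigr => i _; rewrite !tensor_mapE.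
Qed.

(** The components of a kernel element lie in the kernels for the F i. *)
Lemma flat_direct_sum : (forall i, flat (F i)) -> flat S.
Proof.
move=> F_flat A B f f_inj; apply: raddf_inj => t ft0.
have [s ->] := tensor_dsum_sumE t; apply: big1 => i _.
suff -> : tensr A (dproj S i) t = 0 by rewrite raddf0.
apply: (F_flat i A B f f_inj); rewrite raddf0.
have <- : tensr B (dproj S i) (tensor_map f (idfun : {linear S -> S}) t) = 0.
  by rewrite ft0 raddf0.
have := tensor_map_comp (f := idfun) (f' := f) (g := dproj S i) (g' := idfun)
  (f'' := f) (g'' := dproj S i) (fun=> erefl) (fun=> erefl) t.
move<-; exact: tensor_map_comp.
Qed.
End DirectSum.

(** * The sum of all shifts of a complex *)
(** Exactness can be checked on components: the component of a cycle of D in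
    G (m + 1) is a cycle of d m, hence a boundary, and D lifts it. Like the
    splicing lemma this is applied both to S and to A (x) S. *)
Lemma sum_shift_exact (G : int -> zmodType) (T : zmodType)
    (u : forall n, {additive G n -> T}) (pr : forall n, {additive T -> G n})
    (d : forall n : int, {additive G (n + 1)%R -> G n})
    (D : {additive T -> T}) :
    (forall t, exists s : seq int, t = \sum_(n <- s) u n (pr n t)) ->
    (forall n t, pr n (D t) = d n (pr (n + 1) t)) ->
    (forall n x, D (u (n + 1) x) = u n (d n x)) ->
    (forall n, exact_at (d (n + 1)) (d n)) ->
  exact_at D D.
Proof.
move=> tE prD Du d_ex t; split=> [Dt0|[t' <-]].
  have [s ->] := tE t.
  elim/big_rec: _ => [|n y _ [x <-]]; first by exists 0; rewrite raddf0.
  suff [z <-] : exists z, D z = u n (pr n t) by exists (z + x); rewrite raddfD.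
  rewrite -[n](subrK 1); set m := n - 1.
  have /d_ex[z <-] : d m (pr (m + 1) t) = 0 by rewrite -prD Dt0 raddf0.
  by exists (u (m + 1 + 1) z); rewrite Du.
have [s ->] := tE t'; rewrite !raddf_sum; apply: big1 => n _ /=.
rewrite -[n](subrK 1) -[n - 1](subrK 1); set m := n - 1 - 1.
rewrite !Du [d m _](_ : _ = 0) ?raddf0 //.
by apply/d_ex; eexists.
Qed.

Section SumOfShifts.
Variables (R : pzRingType) (F : int -> lmodType R).
Variable d : forall n, {linear F (n + 1) -> F n}.

(** D is described by its components, since not every index k is literally of
    the form n + 1, and so d cannot be read as a family of maps defined on all
    the F k. *)
Lemma shift_ex (S : direct_sum F) :
  exists D : {linear S -> S},
    (forall n x, dproj S n (D x) = d n (dproj S (n + 1) x)) /\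
    (forall n x, D (dinj S (n + 1) x) = dinj S n (d n x)).
Proof.
have [x|y y0|a x x' y y' yE y'E n|D DE] := @linear_of_rel R S S
    (fun x y => forall n, dproj S n y = d n (dproj S (n + 1) x)).
- have [s sx] := dsum_finsupp x.
  pose s' := undup [seq i - 1 | i <- s].
  exists (\sum_(n <- s') dinj S n (d n (dproj S (n + 1) x))) => n.
  rewrite (@dproj_sum _ _ _ S s' (fun k => d k (dproj S (k + 1) x))) //.
    exact: undup_uniq.
  move=> k ks; rewrite sx ?linear0 //; apply: contra ks => ks.
  by rewrite mem_undup; apply/mapP; exists (k + 1); rewrite ?addrK.
- by apply: dsum_ext => n; rewrite y0 !linear0.
- by rewrite !linearP yE y'E.
exists D; split=> // n x; apply/eqP; rewrite -subr_eq0; apply/eqP/dsum_ext => m.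
rewrite linearB DE; have [<-|nm] := eqVneq n m; first by rewrite !dinjK subrr.
have nm1 : n + 1 != m + 1 by apply: contra nm => /eqP/addIr->.
by rewrite !dproj_inj // linear0 subrr.
Qed.

Lemma AC_acyclic_sum (S : direct_sum F) (D : {linear S -> S}) :
    AC_acyclic_flat_complex d ->
    (forall n x, dproj S n (D x) = d n (dproj S (n + 1) x)) ->
    (forall n x, D (dinj S (n + 1) x) = dinj S n (d n x)) ->
  @AC_acyclic_flat_complex R (fun=> S) (fun=> D).
Proof.
move=> [F_flat d_ex td_ex] prD Du; split=> [_|_|A cA _].
- exact: flat_direct_sum.
- apply: (@sum_shift_exact F S (fun n => dinj S n) (fun n => dproj S n)
           (fun n => d n) D) => // x.
  have [s sx] := dsum_finsupp x; exists (undup s).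
  by apply: dsum_sumE => [|i]; rewrite ?undup_uniq ?mem_undup //; exact: sx.
apply: (@sum_shift_exact (fun n => tensor A (F n)) (tensor A S)
          (fun n => tensr A (dinj S n)) (fun n => tensr A (dproj S n))
          (fun n => tensr A (d n)) (tensr A D)) => [t|n t|n t|].
- exact: tensor_dsum_sumE.
- exact: tensr_square.
- exact: tensr_square.
exact: td_ex.
Qed.

End SumOfShifts.

(** * Gorenstein AC-flat modules as summands *)
(** The retraction onto M = Ker (d n) is induced by the projection of the sum
    onto F (n + 1). *)
Lemma gorenstein_summand_strongly (R : pzRingType) (M : lmodType R) :
  gorenstein_AC_flat M ->
  exists X : lmodType R, strongly_gorenstein_AC_flat X /\ retract M X.
Proof.
case=> F [d [n [i [dF [i_inj iker]]]]].
have [S] := direct_sum_ex F.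
have [D [prD Du]] := shift_ex d S.
have [X [k [k_inj kker]]] := kernel_ex D.
exists X; split.
  by exists S, D, k; split=> //; exact: AC_acyclic_sum dF prD Du.
have [m|j jE] := factor_inj (f := dinj S (n + 1) \o i) k_inj.
  apply/kker; rewrite /= Du [d n _](_ : _ = 0) ?linear0 //.
  by apply/iker; exists m.
have [x|r rE] := factor_inj (f := dproj S (n + 1) \o k) i_inj.
  apply/iker; rewrite /= -prD [D _](_ : _ = 0) ?linear0 //.
  by apply/kker; exists x.
by exists j, r => m; apply: i_inj; rewrite rE /= jE /= dinjK.
Qed.

Theorem corollary4p10 (R : pzRingType)
    (hR : closed_under_extensions (@gorenstein_AC_flat R)) (M : lmodType R) :
  gorenstein_AC_flat M <->
  exists X : lmodType R, strongly_gorenstein_AC_flat X /\ direct_summand M X.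
Proof.
split=> [/gorenstein_summand_strongly[X [sX MX]]|].
  by exists X; split=> //; apply/direct_summandP.
move=> [X [[F [d [i [dF iker]]]] MX]].
apply: (gorenstein_retract hR (X := X)); first exact/direct_summandP.
by exists (fun=> F), (fun=> d), 0, i.
Qed.
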